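(* Let $S$ be a standard tableau of type $(i_1,\dots,i_m)$ and let $\widetilde Y_S:=\mathrm{pr}(Y_{\varphi(S)})$ be the corresponding irreducible component of the Spaltenstein variety $\mathrm{Sp}(i_1,\dots,i_m)$. Then $\widetilde Y_S$ consists of all partial flags $F_{i_1}\subset\dots\subset F_{i_m}$ of type $(i_1,\dots,i_m)$ whose subspaces satisfy: (1) for each $l$, $F_{i_l}\subset N^{-1}(F_{i_{l-1}})$; (2) if $i_l$ is in the top row of $S$, $i_l-1$ is in the bottom row and $i_l-1$ is not a double entry, then $F_{i_l}=N^{-1}(F_{i_l-2})$; (3) if $i_l$ and $i_l-1$ are both in the top row of $S$, then: if $F_{i_l-1}=N^{-d}(F_r)$ where $r$ is in the bottom row and not a double entry, then $F_{i_l}=N^{-d-1}(F_{r-1})$; and if $F_{i_l-1}=N^{-d}(\operatorname{im}N^{n-k-j})$ with $0\le j<n-2k$, then $F_{i_l}=N^{-d}(\operatorname{im}N^{n-k-j-1})$. Here $0$ is regarded as lying in the top row and $F_0=\{0\}=\operatorname{im}N^{n-k}$, $F_{i_0}=\{0\}$.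
   Context: Fix integers $n\ge 2k\ge 0$; $V$ is an $n$-dimensional complex vector space with basis $e_1,\dots,e_{n-k},f_1,\dots,f_k$ and $N$ is the nilpotent endomorphism $Ne_i=e_{i-1}$, $Nf_i=f_{i-1}$, $e_0=f_0=0$. $N^{-d}(U)$ denotes the preimage of $U$ under $N^d$. A partial flag of type $(i_1,\dots,i_m)$ ($0<i_1<\dots<i_m=n$) is a chain $F_{i_1}\subset\dots\subset F_{i_m}$ with $\dim F_{i_l}=i_l$; it is $N$-invariant if $NF_{i_l}\subset F_{i_{l-1}}$ ($F_{i_0}=\{0\}$). $\mathrm{Sp}(i_1,\dots,i_m)$ is the variety of $N$-invariant partial flags of that type; $Y=\mathrm{Sp}(1,\dots,n)$ is the Springer fibre; $\mathrm{pr}$ forgets the $F_j$ with $j\notin\{i_1,\dots,i_m\}$. Tableaux: a tableau of type $(i_1,\dots,i_m)$ is a two-row Young diagram (top row $n-k$ boxes, bottom row $k$ boxes) in which $i_l$ occurs exactly $i_l-i_{l-1}$ times; it is row strict if entries strictly decrease along rows, standard if moreover each column's top entry is $\ge$ its bottom entry. An entry $i_l$ with $i_l-i_{l-1}=2$ is a double entry (it appears in both rows). $\varphi(S)$ is obtained from $S$ by replacing the bottom-row copy of each double entry $i_l$ by $i_l-1$. For a standard tableau $\sigma$ of type $(1,\dots,n)$, $Y_\sigma$ is the irreducible component of $Y$ attached to $\sigma$ by the Spaltenstein–Vargas bijection; explicitly (Fung), with $F_0=\{0\}=\operatorname{im}N^{n-k}$ and $0$ in the top row, $Y_\sigma$ consists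 of the full flags with: $F_i\subset N^{-1}(F_{i-1})$ for all $i$; $F_i=N^{-1}(F_{i-2})$ if $i$ is in the top row and $i-1$ in the bottom row of $\sigma$; and if $i,i-1$ are both in the top row: $F_i=N^{-d-1}(F_{r-1})$ whenever $F_{i-1}=N^{-d}(F_r)$ with $r$ in the bottom row, and $F_i=N^{-d}(\operatorname{im}N^{n-k-j-1})$ whenever $F_{i-1}=N^{-d}(\operatorname{im}N^{n-k-j})$, $0\le j<n-2k$. *)

(* Defs.v *)
(* The complex field is  R[i] = complex R  for a realType R
   (every realType is isomorphic to the reals, so this is C). *)
From HB Require Import structures.
From mathcomp Require Import all_boot all_order all_algebra.
From mathcomp Require Import reals.
From mathcomp Require Import complex.
Set Implicit Arguments. Unset Strict Implicit. Unset Printing Implicit Defensive.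
Import Order.TTheory GRing.Theory Num.Theory.

Section Springer.
Variable F : fieldType.
Variables n k : nat.
Local Open Scope ring_scope.

(* V = row vectors 'rV[F]_n; basis index p : 'I_n.
   e_i (1 <= i <= n-k) has index i-1, f_i (1 <= i <= k) has index n-k+i-1.
   Row-vector convention: v |-> v *m N. Row p of N is the image of basis p. *)
Definition Nmx : 'M[F]_n :=
  \matrix_(p, q) (((q.+1 == p :> nat) && (p != (n - k)%N :> nat))%:R).

(* subspaces are represented by (the row spaces of) square matrices *)
Definition preim (d : nat) (U : 'M[F]_n) : 'M[F]_n :=
  kermx (Nmx ^+ d *m cokermx U).

Definition imN (p : nat) : 'M[F]_n := Nmx ^+ p.

(* flags are families  G : nat -> 'M_n ; G_0 is forced to be {0} *)
Definition at0 (G : nat -> 'M[F]_n) (i : nat) : 'M[F]_n :=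
  if i == 0%N then 0 else G i.

(* ---- full flags and the components Y_sigma (Fung's description) ---- *)
Definition full_flag (G : nat -> 'M[F]_n) : Prop :=
  (forall i, (1 <= i <= n)%N -> \rank (G i) = i) /\
  (forall i, (1 <= i < n)%N -> (G i <= G i.+1)%MS).

(* a tableau: (top row, bottom row), read left to right *)
Definition tableau := (seq nat * seq nat)%type.

Definition in_top (T : tableau) (i : nat) : bool := (i == 0%N) || (i \in T.1).
Definition in_bot (T : tableau) (i : nat) : bool := i \in T.2.

Definition in_Ycomp (sigma : tableau) (G0 : nat -> 'M[F]_n) : Prop :=
  let G := at0 G0 in
  full_flag G0 /\
  forall i, (1 <= i <= n)%N ->
    [/\ (G i <= preim 1 (G i.-1))%MS,
        (in_top sigma i -> in_bot sigma i.-1 -> (G i == preim 1 (G (i - 2)%N))%MS)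
      & (in_top sigma i -> in_top sigma i.-1 ->
          (forall d r, in_bot sigma r -> (G i.-1 == preim d (G r))%MS ->
                       (G i == preim d.+1 (G r.-1))%MS) /\
          (forall d j, (j < n - 2 * k)%N ->
                       (G i.-1 == preim d (imN (n - k - j)%N))%MS ->
                       (G i == preim d (imN (n - k - j - 1)%N))%MS))].

Definition valid_type (I : seq nat) : bool :=
  [&& I != [::], sorted ltn (0%N :: I) & last 0%N I == n].

(* i_l for l = 1..m is  nth 0 I (l-1);  i_{l-1} is nth 0 (0 :: I) (l-1) *)
Definition partial_flag (I : seq nat) (F0 : nat -> 'M[F]_n) : Prop :=
  (forall l, (l < size I)%N -> \rank (F0 (nth 0%N I l)) = nth 0%N I l) /\
  (forall l, (l.+1 < size I)%N -> (F0 (nth 0%N I l) <= F0 (nth 0%N I l.+1))%MS).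

Definition row_strict (T : tableau) : bool :=
  [&& size T.1 == (n - k)%N, size T.2 == k,
      sorted gtn T.1 & sorted gtn T.2].

Definition of_type (I : seq nat) (T : tableau) : bool :=
  all (fun x => x \in I) (T.1 ++ T.2) &&
  all (fun l => count_mem (nth 0%N I l) (T.1 ++ T.2)
                == (nth 0%N I l - nth 0%N (0%N :: I) l)%N) (iota 0 (size I)).

Definition standard (I : seq nat) (T : tableau) : bool :=
  [&& row_strict T, of_type I T &
      all (fun c => nth 0%N T.2 c <= nth 0%N T.1 c)%N (iota 0 k)].

Definition double (I : seq nat) (x : nat) : bool :=
  has (fun l => (nth 0%N I l == x) && (nth 0%N I l - nth 0%N (0%N :: I) l == 2)%N)
      (iota 0 (size I)).

Definition phi (I : seq nat) (S : tableau) : tableau :=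
  (S.1, map (fun x => if double I x then x.-1 else x) S.2).

Definition in_pr_Ycomp (I : seq nat) (sigma : tableau) (F0 : nat -> 'M[F]_n) : Prop :=
  exists G, in_Ycomp sigma G /\
    forall l, (l < size I)%N -> (G (nth 0%N I l) == F0 (nth 0%N I l))%MS.

Definition thm47_conditions (I : seq nat) (S : tableau) (F0 : nat -> 'M[F]_n) : Prop :=
  let F := at0 F0 in
  forall l, (l < size I)%N ->
    let i := nth 0%N I l in
    let ip := nth 0%N (0%N :: I) l in
    [/\ (F i <= preim 1 (F ip))%MS,
        (in_top S i -> in_bot S i.-1 -> ~~ double I i.-1 ->
           (F i == preim 1 (F (i - 2)%N))%MS)
      & (in_top S i -> in_top S i.-1 ->
          (forall d r, in_bot S r -> ~~ double I r ->
                       (F i.-1 == preim d (F r))%MS ->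
                       (F i == preim d.+1 (F r.-1))%MS) /\
          (forall d j, (j < n - 2 * k)%N ->
                       (F i.-1 == preim d (imN (n - k - j)%N))%MS ->
                       (F i == preim d (imN (n - k - j - 1)%N))%MS))].

End Springer.

Arguments Nmx {F} n k.
Arguments preim {F} n k d U.
Arguments imN {F} n k p.
Arguments full_flag {F} n G.
Arguments in_Ycomp {F} n k sigma G0.
Arguments partial_flag {F} n I F0.
Arguments in_pr_Ycomp {F} n k I sigma F0.
Arguments thm47_conditions {F} n k I S F0.

(* Main.v *)
(* Restricting a full flag of Y_phi(S) to the type I gives the conditions at once.
   Conversely a partial flag F has to be refined by a subspace G_(x-1) between
   F_(x-2) and F_x for every double entry x.  There F_x = N^-1(F_(x-2)), because
   F_x is contained in N^-1(F_(x-2)), whose dimension is at most x as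
   dim ker N <= 2.

   Condition (3) quantifies over all presentations F_(i-1) = N^-d(G_r), also
   those not coming from the matching of rows, so G_(x-1) must be chosen
   generically.  Two distinct choices meet in F_(x-2), so for given d and i at
   most one of them satisfies F_(i-1) = N^-d(G_(x-1)), unless
   F_(i-1) = N^-d(F_(x-2)).  The infinite ground field lets us avoid these
   finitely many exceptions.  In the remaining case
   F_i <= N^-1(F_(i-1)) = N^-(d+1)(F_(x-2)) = N^-d(F_x), and the latter has
   dimension at most 1 + dim N^-d(G_(x-1)) = i, so equality holds. *)
Require Import Defs.
From HB Require Import structures.
From mathcomp Require Import all_boot all_order all_algebra.
From mathcomp Require Import reals complex.
From mathcomp Require Import zify.
Import Order.TTheory GRing.Theory Num.Theory.
Local Open Scope ring_scope.
Set Implicit Arguments. Unset Strict Implicit. Unset Printing Implicit Defensive.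

(** * Avoiding finitely many exceptions *)

Lemma avoid_unique_matches (T : finType) (bad : nat -> T -> bool) :
  (forall c c' t, bad c t -> bad c' t -> c = c') ->
  exists c, forall t, ~~ bad c t.
Proof.
move=> bad_inj; case: (boolP [forall c : 'I_#|T|.+1, exists t, bad c t]).
  move=> /forallP badT.
  (* Pigeonhole: choosing a bad [t] for each of [#|T|.+1] values of [c] would be injective into
     [T]. *)
  have /fin_all_exists [f fP] (c : 'I_#|T|.+1) : exists t, bad c t.
    exact/existsP.
  have /leq_card : injective f.
    by move=> c c' eqf; apply/val_inj/(bad_inj _ _ (f c)); last rewrite eqf; apply: fP.
  by rewrite card_ord ltnn.
by case/forallPn => c /existsPn badN; exists c.
Qed.

(** * Pencils of subspaces *)

Section Subspaces.
Variables (F : numFieldType) (n : nat).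

Lemma row_notin (m1 m2 : nat) (A : 'M[F]_(m1, n)) (B : 'M[F]_(m2, n)) :
  (\rank A < \rank B)%N -> exists2 u : 'rV_n, (u <= B)%MS & ~~ (u <= A)%MS.
Proof.
move=> ltAB; have /row_subPn[i uA] : ~~ (B <= A)%MS.
  by apply: contraL ltAB => /mxrankS; rewrite -leqNgt.
by exists (row i B); rewrite ?row_sub.
Qed.

Lemma rank_adds_row (m : nat) (A : 'M[F]_(m, n)) (u : 'rV[F]_n) :
  ~~ (u <= A)%MS -> \rank (A + u)%MS = (\rank A).+1.
Proof.
move=> uA; apply/eqP; rewrite eqn_leq; apply/andP; split.
  apply: leq_trans (mxrank_adds_leqif A u).1 _.
  by rewrite -[(\rank A).+1]addn1 leq_add2l rank_leq_row.
by apply: rank_ltmx; rewrite ltmxE addsmxSl addsmx_sub submx_refl.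
Qed.

(** The quotient [B / A] is a plane, and [H c] is the preimage of its line through [u + c v]. In
    characteristic 0 distinct naturals [c] give distinct lines, which meet only in zero. *)
Lemma pencil_between (A B : 'M[F]_n) :
  (A <= B)%MS -> \rank B = (\rank A).+2 ->
  exists H : nat -> 'M[F]_n,
    (forall c, [/\ (A <= H c)%MS, (H c <= B)%MS & \rank (H c) = (\rank A).+1]) /\
    (forall c c', c != c' -> (H c :&: H c' <= A)%MS).
Proof.
move=> sAB rB.
have [|u uB uA] := @row_notin _ _ A B; first by rewrite rB ltnW.
have rAu := rank_adds_row uA.
have [|v vB vAu] := @row_notin _ _ (A + u)%MS B; first by rewrite rAu rB.
pose H c := (A + (u + c%:R *: v)%R)%MS.
have rH c : \rank (H c) = (\rank A).+1.
  apply: rank_adds_row; apply/negP => uvA.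
  (* For [c = 0] this puts [u] in [A]; otherwise it puts [v] in [A + u]. *)
  have [c0|c0] := eqVneq (c%:R : F) 0.
    by move: uvA; rewrite c0 scale0r addr0; apply/negP.
  case/negP: vAu; have := eqmx_scale v c0 => /eqmxP/andP[_ /submx_trans]; apply.
  rewrite -[c%:R *: v](addKr u) addmx_sub //.
    by rewrite eqmx_opp; apply: addsmxSr.
  exact: submx_trans uvA (addsmxSl _ _).
exists H; split=> [c | c c' neq_cc'].
  split=> //; first exact: addsmxSl.
  by rewrite addsmx_sub sAB addmx_sub ?scalemx_sub.
have sub c1 c2 : ((u + c1%:R *: v)%R <= H c1 + H c2)%MS.
  by apply: submx_trans (addsmxSl _ _); apply: addsmxSr.
have vH : (v <= H c + H c')%MS.
  have d0 : (c%:R - c'%:R : F) != 0 by rewrite subr_eq0 eqr_nat.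
  have := eqmx_scale v d0 => /eqmxP/andP[_ /submx_trans]; apply.
  rewrite scalerBl -(addrKA u) [_ + u]addrC opprD addrA.
  rewrite -addrA -opprD addrC [_ + (u + _)]addrC addmx_sub ?eqmx_opp ?sub //.
  by rewrite addsmxC sub.
have uH : (u <= H c + H c')%MS.
  by rewrite -[u](addrK (c%:R *: v)) addmx_sub ?sub // eqmx_opp scalemx_sub.
have AH c1 c2 : (A <= H c1 + H c2)%MS.
  by apply: submx_trans (addsmxSl _ _); apply: addsmxSl.
(* The sum contains [A], [u] and [v], so the rank formula leaves at most [\rank A] for the
   intersection. *)
have rS : ((\rank A).+2 <= \rank (H c + H c')%MS)%N.
  by rewrite -rAu -(rank_adds_row vAu) mxrankS // !addsmx_sub AH uH.
have sAHH : (A <= H c :&: H c')%MS by rewrite sub_capmx !addsmxSl.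
rewrite -(geq_leqif (mxrank_leqif_sup sAHH)).
have := mxrank_sum_cap (H c) (H c'); rewrite !rH addSn addnS => eqr.
by rewrite -(leq_add2l (\rank (H c + H c')%MS)) eqr -!addSn leq_add2r.
Qed.
End Subspaces.

(** * Preimages under powers of the nilpotent map *)

Lemma sub_preim (F : fieldType) (n k m d : nat) (W : 'M[F]_(m, n)) (U : 'M[F]_n) :
  (W <= Defs.preim n k d U)%MS = (W *m (Nmx n k ^+ d) <= U)%MS.
Proof. by rewrite sub_kermx mulmxA -submxE. Qed.

Section Preimages.
Variables (F : numFieldType) (n k : nat).
Implicit Types U W : 'M[F]_n.
Local Notation N := (@Nmx F n k).
Local Notation preim := (@Defs.preim F n k).

Lemma sub_preim1 m (W : 'M[F]_(m, n)) d U :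
  (W <= preim d (preim 1 U))%MS = (W <= preim d.+1 U)%MS.
Proof.
rewrite [LHS]sub_preim [LHS]sub_preim [RHS]sub_preim.
by rewrite -mulmxA mulmxE -exprD addn1.
Qed.

Lemma sub_1preim m (W : 'M[F]_(m, n)) d U :
  (W <= preim 1 (preim d U))%MS = (W <= preim d.+1 U)%MS.
Proof.
rewrite [LHS]sub_preim [LHS]sub_preim [RHS]sub_preim.
by rewrite -mulmxA mulmxE -exprD add1n.
Qed.

Lemma preimS d U W : (U <= W)%MS -> (preim d U <= preim d W)%MS.
Proof. by move=> sUW; rewrite sub_preim (submx_trans _ sUW) // -sub_preim. Qed.

Lemma preim_eqmx d U W : (U :=: W)%MS -> (preim d U :=: preim d W)%MS.
Proof. by move=> eqUW; apply/eqmxP/andP; split; apply: preimS; rewrite eqUW. Qed.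

Lemma cap_preim_sub d U U' W :
  (U :&: U' <= W)%MS -> (preim d U :&: preim d U' <= preim d W)%MS.
Proof.
move=> sUW; rewrite sub_preim; apply: submx_trans sUW.
by rewrite sub_capmx -(sub_preim k d _ U) -(sub_preim k d _ U') capmxSl capmxSr.
Qed.

(** [N ^+ d] induces an injection of [preim d W / preim d U] into [W / U]; the comparison of
    dimensions is written without subtraction. *)
Lemma rank_preim_le d U W : (U <= W)%MS ->
  (\rank (preim d W) + \rank U <= \rank (preim d U) + \rank W)%N.
Proof.
move=> sUW; pose M := N ^+ d *m cokermx U.
(* Rank-nullity on both sides; [preim d U] is the kernel of [M]. *)
rewrite -(mxrank_mul_ker (preim d W) M) -(mxrank_mul_ker W (cokermx U)).
have le1 : (\rank (preim d W *m M) <= \rank (W *m cokermx U))%N.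
  by rewrite mulmxA mxrankS // submxMr // -sub_preim.
have le2 : (\rank (preim d W :&: kermx M) <= \rank (preim d U))%N.
  by rewrite mxrankS // capmxSr.
have le3 : (\rank U <= \rank (W :&: kermx (cokermx U)))%N.
  by rewrite mxrankS // sub_capmx sUW sub_kermx mulmx_coker eqxx.
by rewrite -addnA addnCA; apply: leq_add; last exact: leq_add.
Qed.

(** Each factor [N] either kills a basis vector or lowers its index by one. *)
Lemma Nmx_exp_entry d p q : (N ^+ d) p q != 0 -> p = (q + d)%N :> nat.
Proof.
elim: d p q => [|d IHd] p q.
  by rewrite expr0 -idmxE mxE addn0 pnatr_eq0 eqb0 negbK => /eqP->.
rewrite exprS mxE => sum0.
have [j] : exists j, N p j * (N ^+ d) j q != 0.
  apply/existsP; apply: contraNT sum0 => /existsPn sum0.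
  by rewrite big1 // => j _; apply/eqP/negPn/sum0.
rewrite mulf_eq0 negb_or mxE pnatr_eq0 eqb0 negbK => /andP[/andP[/eqP <- _]].
by move=> /IHd ->; rewrite addnS.
Qed.

Lemma Nmx_nilpotent d : (n <= d)%N -> N ^+ d = 0.
Proof.
move=> le_nd; apply/matrixP => p q; rewrite [RHS]mxE.
apply/eqP/negPn/negP => /Nmx_exp_entry eq_p.
by have := ltn_ord p; rewrite eq_p ltnNge (leq_trans le_nd) // leq_addl.
Qed.

Lemma rank_preim_nilpotent d U : (n <= d)%N -> \rank (preim d U) = n.
Proof.
move=> le_nd; apply/eqP; rewrite -[_ == _]/(row_full _) -sub1mx sub_preim.
by rewrite Nmx_nilpotent // mulmx0 sub0mx.
Qed.

Hypothesis le_2k_n : (2 * k <= n)%N.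

(** A kernel vector is supported on the indices [0] and [n - k] of the first vectors of the two
    Jordan blocks. So [kermx N] factors through a plane: [X] reads these two coordinates and [Y]
    puts them back. *)
Lemma rank_ker_Nmx : (\rank (kermx N) <= 2)%N.
Proof.
pose f (s : 'I_2) := if s == 0 then 0%N else (n - k)%N.
pose X := \matrix_(p < n, s < 2) ((p == f s :> nat)%:R : F).
pose Y := \matrix_(s < 2, q < n) ((q == f s :> nat)%:R : F).
suff -> : kermx N = kermx N *m X *m Y.
  exact: leq_trans (mxrankM_maxr _ _) (rank_leq_row _).
apply/row_matrixP => i; rewrite (row_mul i (kermx N *m X)) (row_mul i (kermx N)).
have: row i (kermx N) *m N = 0 by apply/sub_kermxP; apply: row_sub.
move: (row i (kermx N)) => v vN0.
have entry (q : 'I_n) (s : 'I_2) : q = f s :> nat -> (v *m X) 0 s = v 0 q.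
  move=> eq_q; rewrite mxE (bigD1 q) //= [X q s]mxE eq_q eqxx mulr1.
  rewrite big1 ?addr0 // => p neq_pq; rewrite [X p s]mxE -eq_q.
  by rewrite (inj_eq val_inj) (negPf neq_pq) mulr0.
apply/rowP => q; rewrite mxE big_ord_recl big_ord1.
rewrite [Y ord0 q]mxE [Y (lift _ _) q]mxE /f /=.
have q_lt := ltn_ord q.
have [q0|q0] := eqVneq (q : nat) 0%N.
  (* The existence of [q] gives [n > 0], hence [n - k > 0], so the two indices differ. *)
  have /negPf-> : (q : nat) != (n - k)%N by rewrite q0; lia.
  by rewrite (entry q ord0) // mulr1 mulr0 addr0.
have [qk|qk] := eqVneq (q : nat) (n - k)%N.
  by rewrite (entry q (lift ord0 ord0)) // mulr0 add0r mulr1.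
(* For any other [q], coordinate [q - 1] of [v *m N] is [v 0 q], which therefore vanishes. *)
have q'_lt : (q.-1 < n)%N by lia.
have NE p : N p (Ordinal q'_lt) = ((p == q) && (p != n - k :> nat)%N)%:R.
  by rewrite mxE /= prednK ?lt0n // (inj_eq val_inj) eq_sym.
have /rowP/(_ (Ordinal q'_lt)) := vN0.
rewrite mxE [RHS]mxE (bigD1 q) //= NE eqxx qk mulr1 big1 => [|p neq_pq].
  by rewrite addr0 => ->; rewrite !mulr0 addr0.
by rewrite NE (negPf neq_pq) mulr0.
Qed.

Lemma rank_preim1_le U : (\rank (preim 1 U) <= (\rank U).+2)%N.
Proof.
rewrite -(mxrank_mul_ker (preim 1 U) N) -[(\rank U).+2]addn2 leq_add //.
  by rewrite mxrankS // -[X in _ *m X]expr1 -sub_preim.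
exact: leq_trans (mxrankS (capmxSr _ _)) rank_ker_Nmx.
Qed.

Lemma sub_rank_eqmx m (A : 'M[F]_(m, n)) U :
  (A <= U)%MS -> (\rank U <= \rank A)%N -> (A :=: U)%MS.
Proof.
move=> sAU; rewrite (geq_leqif (mxrank_leqif_sup sAU)) => sUA.
by apply/eqmxP; rewrite sAU.
Qed.
End Preimages.

(** * Generic choice of an intermediate subspace *)

Lemma eqmx_congr (F : fieldType) (n : nat) (A A' B B' : 'M[F]_n) :
  (A :=: A')%MS -> (B :=: B')%MS -> (A == B)%MS = (A' == B')%MS.
Proof. by move=> eqA eqB; rewrite !eqA !eqB. Qed.

(** If two members of the pencil match the same [W i] for the same [d], then [W i] lies in the
    preimage of their intersection, hence in that of [A], and the match is harmless. So each pair
    [(d, i)] excludes at most one member. *)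
Lemma generic_between (F : numFieldType) (n k : nat) (A B : 'M[F]_n)
    (W : nat -> 'M[F]_n) :
  (A <= B)%MS -> \rank B = (\rank A).+2 ->
  exists U : 'M[F]_n,
    [/\ (A <= U)%MS, (U <= B)%MS, \rank U = (\rank A).+1
      & forall d i, (i < n)%N -> (\rank (W i) < n)%N ->
          (W i == Defs.preim n k d U)%MS -> (W i == Defs.preim n k d A)%MS].
Proof.
move=> sAB rB; have [H [Hbetween Hcap]] := pencil_between sAB rB.
pose bad c (t : 'I_n * 'I_n) :=
  (W t.2 == Defs.preim n k t.1 (H c))%MS
    && ~~ (W t.2 == Defs.preim n k t.1 A)%MS.
have [c c' t | c good] := @avoid_unique_matches _ bad.
  case/andP=> /andP[sub_c sup_c] neq_t /andP[/andP[sub_c' _] _].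
  apply/eqP/negPn/negP => neq_cc'; case/negP: neq_t; apply/andP; split.
    apply: submx_trans (cap_preim_sub _ _ (Hcap _ _ neq_cc')).
    by rewrite sub_capmx; apply/andP; split.
  by apply: submx_trans sup_c; apply: preimS; case: (Hbetween c).
have [sAU sUB rU] := Hbetween c; exists (H c).
split; [exact: sAU | exact: sUB | exact: rU | move=> d i lt_in rWi eqWU].
(* For [d >= n] the preimage is the whole space, contrary to the rank of [W i]; hence finitely many
   pairs suffice. *)
have [lt_dn | le_nd] := ltnP d n.
  apply: contraNT (good (Ordinal lt_dn, Ordinal lt_in)) => neqWA.
  by apply/andP; split.
have rWn := etrans (eqmx_rank eqWU) (rank_preim_nilpotent k _ le_nd).
move: rWi; rewrite ltn_neqAle => /andP[/eqP neq_n _]; case: (neq_n rWn).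
Qed.

(** * Arithmetic of types and double entries *)

Section Tableaux.
Variables (n k : nat) (I : seq nat) (S : tableau).
Hypotheses (hI : valid_type n I) (hS : standard n k I S).
Local Open Scope nat_scope.

Let sortedI : sorted ltn (0 :: I). Proof. by case/and3P: hI. Qed.
Let uniqI : uniq (0 :: I). Proof. exact: sorted_uniq ltn_trans ltnn _ sortedI. Qed.

Lemma type_ltn l l' : l < l' -> l' <= size I ->
  nth 0 (0 :: I) l < nth 0 (0 :: I) l'.
Proof.
move=> lt_l lt_l'; apply: (sorted_ltn_nth ltn_trans 0 sortedI) => //.
by rewrite inE /= ltnS (leq_trans (ltnW lt_l)).
Qed.

Lemma type_last : n \in I.
Proof.
case/and3P: hI => + _ /eqP <-; case: (I) => // a s _; exact: mem_last.
Qed.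

Lemma type_bounds i : i \in I -> 0 < i <= n.
Proof.
case/(nthP 0) => l lt_l <-; have /= -> := @type_ltn 0 l.+1 isT lt_l.
case/and3P: hI => _ _ /eqP <-; rewrite -nth_last /=.
have [-> // | neq_l] := eqVneq l (size I).-1.
have lt_l1 : l < (size I).-1 by rewrite ltn_neqAle neq_l -ltnS (ltn_predK lt_l).
by apply/ltnW/(@type_ltn l.+1 (size I).-1.+1); rewrite ?ltnS // (ltn_predK lt_l).
Qed.

(** Entries of [I] are distinct, so only position [l] can witness [double]. *)
Lemma doubleE l : l < size I ->
  Defs.double I (nth 0 I l) = (nth 0 I l - nth 0 (0 :: I) l == 2).
Proof.
move=> lt_l; apply/hasP/idP => [[l'] | dbl]; last first.
  by exists l; rewrite ?mem_iota // eqxx.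
rewrite mem_iota add0n => /andP[_ lt_l'] /andP[/eqP eq_l /eqP <-].
suff -> : l = l' by [].
by apply/eqP; rewrite -(nth_uniq 0 lt_l lt_l') ?eq_l //; case/andP: uniqI.
Qed.

Lemma mem_top_type i : i \in S.1 -> i \in I.
Proof.
case/and3P: hS => _ /andP[/allP sub _] _ iS.
by apply: sub; rewrite mem_cat iS.
Qed.

Lemma mem_bot_type i : i \in S.2 -> i \in I.
Proof.
case/and3P: hS => _ /andP[/allP sub _] _ iS.
by apply: sub; rewrite mem_cat iS orbT.
Qed.

Lemma in_top_type i : in_top S i -> i \in 0 :: I.
Proof.
by case/orP => [/eqP-> | /mem_top_type]; rewrite inE ?eqxx // orbC => ->.
Qed.

(** A strictly decreasing row holds each value at most once, so a multiplicity counts rows. Steps of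
    the type are thus 1 or 2. *)
Lemma type_count l : l < size I ->
  nth 0 I l - nth 0 (0 :: I) l = (nth 0 I l \in S.1) + (nth 0 I l \in S.2).
Proof.
move=> lt_l; case/and3P: hS => /and4P[_ _ st sb] /andP[_ /allP cnt] _.
have /cnt/eqP<- : l \in iota 0 (size I) by rewrite mem_iota.
have gtn_uniq (s : seq nat) : sorted gtn s -> uniq s.
  by apply: sorted_uniq => [x y z /= lt1 lt2 | x /=]; [apply: ltn_trans lt1 | rewrite ltnn].
by rewrite count_cat !count_uniq_mem ?gtn_uniq.
Qed.

Lemma type_step_single l : l < size I -> ~~ Defs.double I (nth 0 I l) ->
  nth 0 (0 :: I) l = (nth 0 I l).-1.
Proof.
move=> lt_l; rewrite doubleE // => ndbl.
have := type_count lt_l; have := @type_ltn l l.+1 (ltnSn l) lt_l.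
by move: ndbl => /=; do 2!case: (_ \in _) => /=; lia.
Qed.

Lemma type_step_double l : l < size I -> Defs.double I (nth 0 I l) ->
  [/\ 1 < nth 0 I l, nth 0 (0 :: I) l = nth 0 I l - 2,
      (nth 0 I l).-1 \notin 0 :: I, nth 0 I l \in S.1 & nth 0 I l \in S.2].
Proof.
move=> lt_l; rewrite doubleE // => /eqP dbl.
have := type_count lt_l; rewrite dbl.
case: (nth 0 I l \in S.1); case: (nth 0 I l \in S.2) => // _.
split=> //; [lia | lia |].
(* Positions of [0 :: I] up to [l] carry values at most [nth 0 I l - 2], later ones at least
   [nth 0 I l]. *)
apply/(nthP 0) => -[l' lt_l' eq_l'].
have [lt_ll' | gt_ll' | eq_ll'] := ltngtP l' l.
- by have := type_ltn lt_ll' (ltnW lt_l); rewrite eq_l'; lia.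
- have [eq1 | neq1] := eqVneq l' l.+1; first by move: eq_l'; rewrite eq1 /=; lia.
  have lt1 : l.+1 < l' by lia.
  have : nth 0 I l < nth 0 (0 :: I) l' by exact: (type_ltn lt1 lt_l').
  by rewrite eq_l'; lia.
- by move: dbl; rewrite -{2}eq_ll' eq_l'; lia.
Qed.

Lemma pred_single i : i \in I -> ~~ Defs.double I i -> i.-1 \in 0 :: I.
Proof.
case/(nthP 0) => l lt_l <- /type_step_single <- //.
by rewrite mem_nth //= ltnS ltnW.
Qed.

Lemma pred2_double i : i \in I -> Defs.double I i ->
  [/\ 1 < i, i - 2 \in 0 :: I, i.-1 \notin 0 :: I, i \in S.1 & i \in S.2].
Proof.
case/(nthP 0) => l lt_l <- /type_step_double[] // -> <- -> -> ->.
by split=> //; rewrite mem_nth //= ltnS ltnW.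
Qed.

(** Downward induction from [n]: the predecessor of a single entry is one less, that of a double
    entry two less. *)
Lemma type_cover i : 0 < i <= n -> i \in I \/ i.+1 \in I /\ Defs.double I i.+1.
Proof.
have inI0 j : 0 < j -> j \in 0 :: I -> j \in I by rewrite inE; case: j.
have [m] := ubnP (n - i); elim: m i => // m IHm i lt_m /andP[i_gt0].
rewrite leq_eqVlt => /predU1P[-> | lt_in]; first by left; exact: type_last.
have [iI1 | [iI2 dbl2]] := IHm i.+1 ltac:(lia) lt_in; last first.
  have [_ + _ _ _] := pred2_double iI2 dbl2.
  by rewrite subn2 => /inI0; left; auto.
have [dbl1 | ndbl1] := boolP (Defs.double I i.+1); first by right.
by left; exact: inI0 i_gt0 (pred_single iI1 ndbl1).
Qed.

End Tableaux.

(** * The tableau [phi I S] and full flags *)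

Section Components.
Variables (F : numFieldType) (n k : nat) (I : seq nat) (S : tableau).
Hypotheses (le_2k_n : (2 * k <= n)%N) (hI : valid_type n I).
Hypothesis hS : standard n k I S.
Implicit Types G W : nat -> 'M[F]_n.
Local Notation preim := (@Defs.preim F n k).

Lemma at0_gt0 G i : (0 < i)%N -> at0 G i = G i.
Proof. by case: i. Qed.

(** This split drives the refinement: an unchanged entry leads to a condition on the given flag, a
    lowered one to an inserted subspace. *)
Lemma in_bot_phi r : in_bot (phi I S) r ->
  in_bot S r /\ ~~ Defs.double I r \/ in_bot S r.+1 /\ Defs.double I r.+1.
Proof.
case/mapP => b bS ->; case: ifP => [dbl | /negbT]; last by left.
by right; have [/ltnW/prednK ->] := pred2_double hI hS (mem_bot_type hS bS) dbl.
Qed.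

Lemma in_bot_phi_single r :
  in_bot S r -> ~~ Defs.double I r -> in_bot (phi I S) r.
Proof. by move=> rS ndbl; apply/mapP; exists r; rewrite // (negPf ndbl). Qed.

Lemma in_bot_phi_double r : r \in I -> Defs.double I r -> in_bot (phi I S) r.-1.
Proof.
move=> rI dbl; have [_ _ _ _ rS] := pred2_double hI hS rI dbl.
by apply/mapP; exists r; rewrite // dbl.
Qed.

Lemma nth_type_pred l : (l < size I)%N ->
  nth 0%N (0%N :: I) l =
    (if Defs.double I (nth 0%N I l) then nth 0%N I l - 2 else (nth 0%N I l).-1)%N.
Proof.
move=> lt_l; case: ifP => [dbl | /negbT ndbl].
  by have [] := type_step_double hI hS lt_l dbl.
exact: (type_step_single hI hS).
Qed.

Lemma full_flag_le G i j : full_flag n G ->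
  (i <= j <= n)%N -> (at0 G i <= at0 G j)%MS.
Proof.
case=> _ step; elim: j => [|j IHj]; first by rewrite leqn0 => /andP[/eqP-> _].
rewrite leq_eqVlt ltnS => /andP[/predU1P[-> // | le_ij] lt_jn].
apply: submx_trans (IHj _) _; first by rewrite le_ij ltnW.
by case: j lt_jn {IHj le_ij} => [|j] lt_jn; [apply: sub0mx | apply: step].
Qed.

(** * Restriction of full flags *)

Lemma Ycomp_conditions W :
  in_pr_Ycomp n k I (phi I S) W ->
  partial_flag n I W /\ thm47_conditions n k I S W.
Proof.
case=> G [[flagG condG] eqGW].
have E i : i \in 0%N :: I -> (at0 G i :=: at0 W i)%MS.
  rewrite inE => /predU1P[-> // | iI]; have /andP[i_gt0 _] := type_bounds hI iI.
  by rewrite !at0_gt0 //; case/(nthP 0%N): iI => l lt_l <-; apply/eqmxP/eqGW.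
have E' i : i \in I -> (at0 G i :=: at0 W i)%MS.
  by move=> iI; apply: E; rewrite inE iI orbT.
have memI l : (l < size I)%N -> nth 0%N I l \in I by apply: mem_nth.
have at0I (V : nat -> 'M[F]_n) l : (l < size I)%N -> at0 V (nth 0%N I l) = V (nth 0%N I l).
  by move=> /memI/(type_bounds hI)/andP[i_gt0 _]; rewrite at0_gt0.
split; first split.
- move=> l lt_l; have iI := memI l lt_l; rewrite -at0I // -(E' _ iI).
  have i_bd := type_bounds hI iI; have /andP[i_gt0 _] := i_bd.
  by rewrite at0_gt0 //; case: flagG => rankG _; apply: rankG.
- move=> l lt_l; have lt_l' := ltnW lt_l.
  rewrite -(at0I W l) // -(at0I W l.+1) //.
  rewrite -(E' _ (memI _ lt_l)) -(E' _ (memI _ lt_l')).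
  apply: full_flag_le => //.
  have /andP[_ ->] := type_bounds hI (memI _ lt_l).
  by rewrite ltnW // (@type_ltn _ _ hI l.+1 l.+2).
move=> l lt_l; have iI := memI l lt_l; rewrite nth_type_pred //.
move: (nth 0%N I l) iI => i iI {lt_l}.
have [c1 c2 c3] := condG i (type_bounds hI iI).
split.
- case: ifP => [dbl | /negbT ndbl]; last first.
    by rewrite -(E' _ iI) -(preim_eqmx k 1 (E _ (pred_single hI hS iI ndbl))).
  (* For double [i], [phi I S] has [i] on top and [i - 1] at the bottom, so the subspace at [i] is
     the preimage of the one at [i - 2]. *)
  have [_ i2I _ iS _] := pred2_double hI hS iI dbl.
  have := c2 _ (in_bot_phi_double iI dbl); rewrite /in_top iS orbT => /(_ isT).
  by rewrite (eqmx_congr (E' _ iI) (preim_eqmx k 1 (E _ i2I))) => /andP[].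
(* The single entry [i - 1] survives in the bottom row, and [i - 2] is in the type or zero. *)
- move=> iS i1S ndbl; have i1I := mem_bot_type hS i1S.
  rewrite -(eqmx_congr (E' _ iI) (preim_eqmx k 1 (E _ _))); last first.
    by rewrite subn2; apply: (pred_single hI hS i1I ndbl).
  exact/c2/in_bot_phi_single.
move=> iS i1S; have [c3r c3j] := c3 iS i1S.
have i1I := in_top_type hS i1S; split=> [d r rS ndbl | d j lt_j].
  have rI := mem_bot_type hS rS.
  rewrite -(eqmx_congr (E _ i1I) (preim_eqmx k d (E' _ rI))) => eqr.
  rewrite -(eqmx_congr (E' _ iI) (preim_eqmx k _ (E _ (pred_single hI hS rI ndbl)))).
  by apply: c3r eqr; apply: in_bot_phi_single.
rewrite -(eqmx_congr (E _ i1I) (eqmx_refl _)) => eqj.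
by rewrite -(eqmx_congr (E' _ iI) (eqmx_refl _)); apply: c3j eqj.
Qed.

(** * Refinement of partial flags *)

Lemma conditions_Ycomp W :
  partial_flag n I W -> thm47_conditions n k I S W ->
  in_pr_Ycomp n k I (phi I S) W.
Proof.
case=> rankW leW condW.
have memI0 i : i \in I -> i \in 0%N :: I by rewrite inE orbC => ->.
have gt0I i : i \in I -> (0 < i)%N by move/(type_bounds hI)/andP=> [].
have lenI i : i \in I -> (i <= n)%N by move/(type_bounds hI)/andP=> [].
have rW i : i \in 0%N :: I -> \rank (at0 W i) = i.
  rewrite inE => /predU1P[-> | iI]; first exact: mxrank0.
  by rewrite at0_gt0 ?gt0I //; case/(nthP 0%N): iI => l lt_l <-; apply: rankW.
have mono_step i : i \in I ->
    (at0 W (if Defs.double I i then i - 2 else i.-1)%N <= at0 W i)%MS.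
  case/(nthP 0%N) => l lt_l <-; rewrite -nth_type_pred //.
  case: l lt_l => [|l] lt_l; first exact: sub0mx.
  have pos j : (j < size I)%N -> (0 < nth 0%N I j)%N.
    by move=> lt_j; rewrite gt0I ?mem_nth.
  rewrite [nth _ _ _.+1]/(nth 0%N I l) (at0_gt0 _ (pos _ (ltnW lt_l))).
  by rewrite (at0_gt0 _ (pos _ lt_l)); apply: leW.
have Wcond i : i \in I ->
    [/\ (at0 W i <= preim 1 (at0 W (if Defs.double I i then i - 2 else i.-1)%N))%MS,
        (in_top S i -> in_bot S i.-1 -> ~~ Defs.double I i.-1 ->
           (at0 W i == preim 1 (at0 W (i - 2)%N))%MS)
      & (in_top S i -> in_top S i.-1 ->
          (forall d r, in_bot S r -> ~~ Defs.double I r ->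
                       (at0 W i.-1 == preim d (at0 W r))%MS ->
                       (at0 W i == preim d.+1 (at0 W r.-1))%MS) /\
          (forall d j, (j < n - 2 * k)%N ->
                       (at0 W i.-1 == preim d (imN n k (n - k - j)%N))%MS ->
                       (at0 W i == preim d (imN n k (n - k - j - 1)%N))%MS))].
  case/(nthP 0%N) => l lt_l <-; rewrite -nth_type_pred //.
  exact: condW.
have pred2K m : (1 < m)%N -> m = m.-2.+2 by case: m => [|[]].
(* One generic subspace per double entry [x], with default [0] elsewhere. Genericity against the
   given flag suffices, since a top-row [i - 1] always lies in [0 :: I]. *)
have /fin_all_exists [g gP] (x : 'I_n.+1) : exists U : 'M[F]_n,
    (x : nat) \in I -> Defs.double I x ->
    [/\ (at0 W (x - 2)%N <= U)%MS, (U <= at0 W x)%MS, \rank U = x.-1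
      & forall d i, (i < n)%N -> (\rank (at0 W i) < n)%N ->
          (at0 W i == preim d U)%MS -> (at0 W i == preim d (at0 W (x - 2)%N))%MS].
  have [/andP[xI dbl] | no] := boolP (((x : nat) \in I) && Defs.double I x); last first.
    by exists 0 => xI dbl; rewrite xI dbl in no.
  have [x_gt1 x2I _ _ _] := pred2_double hI hS xI dbl.
  have sub := mono_step x xI; rewrite dbl in sub.
  have [|U [sAU sUB rU gen]] := generic_between k (at0 W) sub.
    by rewrite (rW _ x2I) (rW _ (memI0 _ xI)) subn2 -(pred2K _ x_gt1).
  exists U => _ _; split; [exact: sAU | exact: sUB | | exact: gen].
  by rewrite rU (rW _ x2I) subn2 {2}(pred2K _ x_gt1).
(* An index in [1..n] missing from [I] is [x - 1] with [x] double, so [g] is read at [x = i + 1],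
   where [inord] is exact. *)
pose G i := if i \in I then W i else g (inord i.+1).
have GI i : i \in 0%N :: I -> at0 G i = at0 W i.
  rewrite inE => /predU1P[-> // | iI].
  by rewrite !at0_gt0 ?gt0I // /G iI.
have GD x : x \in I -> Defs.double I x ->
    [/\ (at0 W (x - 2)%N <= at0 G x.-1)%MS, (at0 G x.-1 <= at0 W x)%MS,
        \rank (at0 G x.-1) = x.-1
      & forall d i, (i < n)%N -> (\rank (at0 W i) < n)%N ->
          (at0 W i == preim d (at0 G x.-1))%MS ->
          (at0 W i == preim d (at0 W (x - 2)%N))%MS].
  move=> xI dbl; have [x_gt1 _ x1I _ _] := pred2_double hI hS xI dbl.
  have x1_gt0 : (0 < x.-1)%N by lia.
  move: x1I; rewrite inE => /norP[_ /negPf x1I].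
  rewrite (at0_gt0 G x1_gt0) /G x1I (prednK (gt0I _ xI)).
  have inord_x : (inord x : 'I_n.+1) = x :> nat by rewrite inordK ?ltnS ?lenI.
  by have := gP (inord x); rewrite inord_x => /(_ xI dbl).
exists G; split; last first.
  by move=> l lt_l; rewrite /G mem_nth //; apply/eqmxP.
have cover i : (1 <= i <= n)%N -> i \in I \/ i.+1 \in I /\ Defs.double I i.+1.
  exact: type_cover hI hS i.
split; first split.
- move=> i i_bd; have /andP[i_gt0 _] := i_bd; rewrite -(at0_gt0 G i_gt0).
  have [iI | [iI1 dbl]] := cover i i_bd.
    by rewrite GI ?rW ?memI0.
  by have [_ _ ->] := GD _ iI1 dbl.
- move=> i /andP[i_gt0 lt_in]; rewrite -(at0_gt0 G i_gt0) -(@at0_gt0 G i.+1) //.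
  have [iI1 | [iI2 dbl2]] := cover i.+1 lt_in; last first.
    have [sub _ _ _] := GD _ iI2 dbl2.
    have [_ + _ _ _] := pred2_double hI hS iI2 dbl2.
    by move: sub; rewrite subn2 => sub iI; rewrite GI.
  have [dbl1 | ndbl1] := boolP (Defs.double I i.+1).
    by have [_ sub _ _] := GD _ iI1 dbl1; rewrite [at0 G i.+1]GI ?memI0.
  have := mono_step _ iI1; rewrite (negPf ndbl1) => sub.
  have iI0 : i \in 0%N :: I := pred_single hI hS iI1 ndbl1.
  by rewrite (GI _ iI0) (GI _ (memI0 _ iI1)).
move=> i i_bd; have /andP[i_gt0 le_in] := i_bd.
have topI : in_top (phi I S) i -> i \in I.
  by move/(in_top_type hS); rewrite inE gtn_eqF.
split.
(* An inserted [G i] lies in the given subspace at [i + 1], which maps into that at [i - 1]. For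
   double [i], enlarging [i - 2] to the inserted [i - 1] keeps the inclusion. *)
- have [iI | [iI1 dbl1]] := cover i i_bd; last first.
    have [sub c _ _] := GD _ iI1 dbl1.
    have [+ _ _] := Wcond _ iI1; rewrite dbl1.
    have [_ + _ _ _] := pred2_double hI hS iI1 dbl1.
    by rewrite subn2 => i1I; rewrite [at0 G i.-1]GI //; apply: submx_trans c.
  rewrite GI ?memI0 //; have [+ _ _] := Wcond _ iI.
  case: ifP => [dbl | /negbT ndbl]; last by rewrite GI //; apply: (pred_single hI hS iI ndbl).
  by have [sub _ _ _] := GD _ iI dbl => /submx_trans; apply; apply: preimS.
- move=> iS; have iI := topI iS; rewrite (GI i) ?memI0 //.
  case/in_bot_phi => [[bS ndbl] | [bS dbl]].
    rewrite GI; last first.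
      by rewrite subn2; exact: (pred_single hI hS (mem_bot_type hS bS) ndbl).
    by have [_ c2 _] := Wcond _ iI; apply: c2.
  (* A lowered bottom entry [i - 1] means that [i] is double; the inclusion is then an equality by
     dimension. *)
  rewrite prednK // in bS dbl; have [i_gt1 i2I _ _ _] := pred2_double hI hS iI dbl.
  rewrite GI //; have [+ _ _] := Wcond _ iI; rewrite dbl => sub.
  apply/eqmxP/(sub_rank_eqmx sub); apply: leq_trans (rank_preim1_le le_2k_n _) _.
  by rewrite (rW _ i2I) (rW _ (memI0 _ iI)) subn2 -(pred2K _ i_gt1).
move=> iS i1S; have iI := topI iS; have i1I := in_top_type hS i1S.
have ndbl : ~~ Defs.double I i.
  by apply/negP => /(pred2_double hI hS iI)[_ _ /negP].
rewrite (GI i) ?memI0 // (GI i.-1) //.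
have [subW _ c3] := Wcond _ iI; have [c3r c3j] := c3 iS i1S; rewrite (negPf ndbl) in subW.
split=> // d r /in_bot_phi[[rS nd] | [rS dbl]].
  have rI := mem_bot_type hS rS.
  rewrite (GI _ (memI0 _ rI)) (GI _ (pred_single hI hS rI nd)).
  exact: c3r.
have rI := mem_bot_type hS rS.
have [subl subr rU gen] := GD _ rI dbl; have [_ r2I _ _ _] := pred2_double hI hS rI dbl.
move=> /= eqi1; rewrite /= in subl subr rU gen.
have lt_i1 : (i.-1 < n)%N by rewrite (prednK i_gt0).
have rW1 : (\rank (at0 W i.-1) < n)%N by rewrite rW.
(* Here [r + 1] is double and [G r] inserted; genericity lets the subspace at [r - 1] replace it. *)
have := gen d _ lt_i1 rW1 eqi1; move: subl subr r2I; rewrite subn2 /= => subl subr r2I eqi.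
rewrite GI //; apply/eqmxP/sub_rank_eqmx.
  rewrite -sub_1preim; apply: submx_trans subW _; apply: preimS.
  by case/andP: eqi.
have [+ _ _] := Wcond _ rI; rewrite dbl subn2 /= => subr1.
have eqB : (at0 W r.+1 :=: preim 1 (at0 W r.-1))%MS.
  apply: (sub_rank_eqmx subr1); apply: leq_trans (rank_preim1_le le_2k_n _) _.
  rewrite (rW _ r2I) (rW _ (memI0 _ rI)) prednK //.
  by have [] := pred2_double hI hS rI dbl.
have le1 : (\rank (preim d.+1 (at0 W r.-1)) <= \rank (preim d (at0 W r.+1)))%N.
  by apply: mxrankS; rewrite (preim_eqmx k d eqB) sub_preim1.
(* Passing from [G r] to the subspace at [r + 1] adds at most one dimension to the preimage, so its
   rank is at most [(i - 1) + 1]. *)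
have := rank_preim_le k d subr; rewrite rU -(eqmx_rank eqi1) (rW _ i1I).
rewrite (rW _ (memI0 _ rI)) => le2.
rewrite (rW _ (memI0 _ iI)); apply: leq_trans le1 _.
by move: le2; rewrite /= addnS -addSn (prednK i_gt0) leq_add2r.
Qed.
End Components.

Theorem theorem4p7 (R : realType) (n k : nat) (hnk : (2 * k <= n)%N)
  (I : seq nat) (hI : valid_type n I) (S : tableau)
  (hS : standard n k I S) (F : nat -> 'M[R[i]]_n) :
  in_pr_Ycomp n k I (phi I S) F <->
  partial_flag n I F /\ thm47_conditions n k I S F.
Proof.
split; first exact: Ycomp_conditions.
by case; apply: conditions_Ycomp.
Qed.
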